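(* Let $\Phi: M_2(\mathbb{C}) \to M_2(\mathbb{C})$ be a unital linear map. Then $\Phi \in \mathcal{E}_2$ if and only if there is a unitary $U \in M_2(\mathbb{C})$ such that $\Phi_U$ has one of the forms below: (i) $\Phi_U(A)=\rho(A)I$ for all $A \in M_2(\mathbb{C})$, where $\rho \in M_2(\mathbb{C})^*$ is a state; (ii) $\Phi_U(A)= a_{11}e_{11} + a_{22}e_{22}$ for all $A=\sum_{i,j=1}^2 a_{ij}e_{ij} \in M_2(\mathbb{C})$; (iii) $\Phi_U(A)=A$ for all $A \in M_2(\mathbb{C})$. Consequently, if $\phi: M_2(\mathbb{C}) \to M_2(\mathbb{C})$ is a unital $q$-positive map, then $\operatorname{rank}(\phi) \neq 3$.
   Context: $\mathcal{E}_n$ denotes the set of all unital completely positive linear maps $\Phi: M_n(\mathbb{C}) \to M_n(\mathbb{C})$ with $\Phi^2 = \Phi\circ\Phi=\Phi$. Here $\{e_{ij}\}$ are the standard matrix units. For a linear map $\Phi: M_n(\mathbb{C}) \to M_n(\mathbb{C})$ and a unitary $U \in M_n(\mathbb{C})$, $\Phi_U$ is the map $\Phi_U(A) = U^*\Phi(UAU^* )U$; maps related this way are called conjugate. A state is a positive linear functional taking the value $1$ at $I$. A linear map $\phi: M_n(\mathbb{C}) \to M_n(\mathbb{C})$ is $q$-positive if $\phi$ has no negative eigenvalues and $\phi(I+t\phi)^{-1}$ is completely positive for all $t \geq 0$ (here $I$ in $I+t\phi$ is the identity map on $M_n(\mathbb{C})$ and the product is composition). The rank of $\phi$ is the dimension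 of its range. *)

(* Defs.v *)
From HB Require Import structures.
From mathcomp Require Import all_boot all_order all_algebra.
From mathcomp Require Import sesquilinear spectral.
From mathcomp Require Export complex.
From mathcomp Require Import reals.

Set Implicit Arguments.
Unset Strict Implicit.
Unset Printing Implicit Defensive.

Import Order.TTheory GRing.Theory Num.Theory.
Local Open Scope ring_scope.
Local Open Scope sesquilinear_scope.

(* In a numClosedFieldType such as R[i], [0 <= z] means that z is real and
   nonnegative and [a < 0] that a is real and negative. *)

(* The condition forces A to be Hermitian, since the scalars form a complex
   field. *)
Definition psdmx (C : numClosedFieldType) (n : nat) (A : 'M[C]_n) : Prop :=
  forall v : 'cV[C]_n, 0 <= (v^t* *m A *m v) 0 0.

Definition unital (C : numClosedFieldType) (n : nat)
    (Phi : 'End('M[C]_n)) : Prop :=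
  Phi 1%:M = 1%:M.

(* M_k(M_n(C)) is identified with the k x k block matrices with blocks of
   size n; [ampliation k Phi] is id_k (x) Phi, i.e., Phi applied blockwise. *)
Definition ampliation (C : numClosedFieldType) (n k : nat)
    (Phi : 'End('M[C]_n)) (A : 'M[C]_(\sum_(i < k) n)) :
    'M[C]_(\sum_(i < k) n) :=
  \mxblock_(i < k, j < k) Phi (submxblock A i j).

Definition completely_positive (C : numClosedFieldType) (n : nat)
    (Phi : 'End('M[C]_n)) : Prop :=
  forall (k : nat) (A : 'M[C]_(\sum_(i < k) n)),
    psdmx A -> psdmx (ampliation Phi A).

(* The set E_n of unital completely positive idempotents of M_n(C). *)
Definition ucp_idempotent (C : numClosedFieldType) (n : nat)
    (Phi : 'End('M[C]_n)) : Prop :=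
  [/\ unital Phi, completely_positive Phi & (Phi \o Phi)%VF = Phi].

Definition conj_map (C : numClosedFieldType) (n : nat)
    (Phi : 'End('M[C]_n)) (U : 'M[C]_n) (A : 'M[C]_n) : 'M[C]_n :=
  U^t* *m Phi (U *m A *m U^t*) *m U.

Definition is_state (C : numClosedFieldType) (n : nat)
    (rho : {scalar 'M[C]_n}) : Prop :=
  (forall A : 'M[C]_n, psdmx A -> 0 <= rho A) /\ rho 1%:M = 1.

(* [(f^-1)%VF] is in general only a right inverse of f on its range; here
   [\1 + t *: phi] is bijective, because phi has no negative eigenvalue and
   t >= 0, so this is the actual inverse. *)
Definition q_positive (C : numClosedFieldType) (n : nat)
    (phi : 'End('M[C]_n)) : Prop :=
  (forall a : C, a < 0 -> ~~ passmx.leigenvalue phi a) /\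
  (forall t : C, 0 <= t ->
     completely_positive (phi \o (\1%VF + t *: phi)%R^-1)%VF).

(* Main.v *)
Require Import Defs.
From HB Require Import structures.
From mathcomp Require Import all_boot all_order all_algebra.
From mathcomp Require Import sesquilinear spectral.
From mathcomp Require Import reals ring.

(** Complete positivity enters in one form only.  The block matrix with blocks
    [delta_mx i j] is positive, so the image of this matrix under a completely
    positive [f] (its Choi matrix) is positive: it is Hermitian, and its 2 x 2
    minors give [`|f e_ij k l|^2 <= (f e_ii k k) * (f e_jj l l)].  Hence [f]
    commutes with the adjoint ([cp_adjoint]); if [f 1 = c] then the entries of
    [f B] are at most [c] times the sum of the moduli of the entries of [B]
    ([cp_entry_bound]); and if [f] fixes every [e_ii] then it multiplies each
    entry of its argument by a constant ([cp_schur_multiplier]).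

    Classification.  Let [Phi] be a unital completely positive idempotent of
    the 2 x 2 matrices.  If all its values are scalar matrices, it is given by
    a state.  Otherwise it fixes a nonscalar matrix, hence, since its range is
    stable under adjoints, a nonscalar Hermitian matrix [H].  In a basis
    diagonalizing [H] the map fixes [1] and a diagonal matrix with two distinct
    entries, hence [e_00] and [e_11], so it is an entrywise multiplier; it
    multiplies the entry (0, 1) by some [s] and the entry (1, 0) by [s^*].
    Idempotence forces [s = 0], which is the diagonal form, or [s = 1], which
    is the identity.  The converse holds because the three forms are built from
    states and from maps [A |-> V^t* A V].

    Rank.  The three forms have rank 1, 2 and 4.  A unital q-positive [phi]
    reduces to them because there is a unital completely positive idempotent
    [P] with the same range ([q_positive_projection]).  This [P] is the limit
    of [t psi_t] as [t] grows, where [psi_t = phi (1 + t phi)^-1], but no limit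
    is taken: as [psi_t 1 = (1 + t)^-1], the entry bound gives
    [psi_t B = O(1 / t)] for each fixed [B].  If [phi y = x] and [phi x = 0]
    then [psi_t y = x] for all [t], so [x = 0]: the kernel and the range of
    [phi] are complementary.  With [P] the projection onto the range along the
    kernel and [W] a linear map such that [P = phi W], one has
    [P = t psi_t + psi_t W], so that [P] is completely positive up to an error
    [O(1 / t)], for all [t], hence exactly. *)

Set Implicit Arguments.
Unset Strict Implicit.
Unset Printing Implicit Defensive.

Import Order.TTheory GRing.Theory Num.Theory.
Local Open Scope ring_scope.
Local Open Scope sesquilinear_scope.

(** * Positive kernels *)

Section Forms.
Variable C : numClosedFieldType.

Definition psd_kernel (T : finType) (G : T -> T -> C) :=
  forall x : T -> C, 0 <= \sum_s \sum_t (x s)^* * G s t * x t.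

(** Testing positivity on vectors supported on at most two points. *)
Lemma psd_kernel_two_points (T : finType) (G : T -> T -> C) (s t : T) (a b : C) :
  psd_kernel G ->
  0 <= a^* * a * G s s + a^* * b * G s t + b^* * a * G t s + b^* * b * G t t.
Proof.
move=> /(_ (fun r => a * (r == s)%:R + b * (r == t)%:R)).
have sumE (F : T -> C) (c d : C) :
    \sum_q F q * (c * (q == s)%:R + d * (q == t)%:R) = c * F s + d * F t.
  under eq_bigr do rewrite mulrDr !mulrA.
  rewrite big_split /= (bigD1 s) //= [X in _ + X + _]big1 => [|q /negPf ->].
    rewrite (bigD1 t) //= big1 => [|q /negPf ->]; last by rewrite mulr0.
    by rewrite !eqxx !mulr1 !addr0 ![_ * F _]mulrC.
  by rewrite mulr0.
rewrite (eq_bigr (fun r => (a * G r s + b * G r t)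
   * (a^* * (r == s)%:R + b^* * (r == t)%:R))); last first.
  move=> r _; rewrite sumE rmorphD !rmorphM /= !conjC_nat; ring.
by rewrite sumE; congr (_ <= _); ring.
Qed.

Lemma psd_kernel_diag (T : finType) (G : T -> T -> C) s :
  psd_kernel G -> 0 <= G s s.
Proof.
move=> /(psd_kernel_two_points s s 1 0).
by rewrite rmorph1 rmorph0 !(mul0r, mulr0, mul1r, addr0).
Qed.

(** Polarization: reality of the form at [e_s + e_t] and at [e_s + 'i e_t]
    determines [G t s] from [G s t]. *)
Lemma psd_kernel_conj (T : finType) (G : T -> T -> C) s t :
  psd_kernel G -> G t s = (G s t)^*.
Proof.
move=> psdG.
have Gs := psd_kernel_diag s psdG; have Gt := psd_kernel_diag t psdG.
have /CrealP := ger0_real (psd_kernel_two_points s t 1 1 psdG).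
have /CrealP := ger0_real (psd_kernel_two_points s t 1 'i psdG).
move/ger0_real/CrealP: Gs; move/ger0_real/CrealP: Gt.
rewrite !(rmorphD, rmorphM, rmorphN, rmorph1, conjCi) /= !conjCi opprK.
move=> -> -> hi h1.
have i0 : 'i != 0 :> C by exact: neq0Ci.
have h1' : (G s t)^* + (G t s)^* = G s t + G t s.
  by apply/subr0_eq; move/eqP: h1; rewrite -subr_eq0 => /eqP <-; ring.
have hi' : (G t s)^* - (G s t)^* = G s t - G t s.
  apply: (mulfI i0); apply/subr0_eq; move/eqP: hi; rewrite -subr_eq0 => /eqP <-.
  ring.
have : (G s t)^* *+ 2 = G t s *+ 2.
  rewrite !mulr2n.
  have -> : (G s t)^* + (G s t)^*
      = ((G s t)^* + (G t s)^*) - ((G t s)^* - (G s t)^*) by ring.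
  by rewrite h1' hi'; ring.
by move/eqP; rewrite eqrMn2r // => /eqP.
Qed.

(** When [G s s] is nonzero the form is tested at [- G s t e_s + G s s e_t].
    When it vanishes, the form at [x e_s + e_t] is real-affine in [x], which forces
    [G s t = 0]. *)
Lemma psd_kernel_minor (T : finType) (G : T -> T -> C) s t :
  psd_kernel G -> `|G s t| ^+ 2 <= G s s * G t t.
Proof.
move=> psdG; rewrite normCK.
have Gs := psd_kernel_diag s psdG; have Gt := psd_kernel_diag t psdG.
have Ets := psd_kernel_conj s t psdG.
have [Gs0|Gs0] := eqVneq (G s s) 0.
  have nn : 0 <= G s t * (G s t)^* by rewrite mul_conjC_ge0.
  suff : G s t * (G s t)^* == 0 by move/eqP ->; rewrite Gs0 mul0r.
  rewrite eq_le nn andbT real_leNgt ?ger0_real // ?real0.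
  apply/negP => pos.
  (* This coefficient makes the form take the negative value
     [- (G t t + 2)]. *)
  pose c := (G t t + 1) / (G s t * (G s t)^*).
  have cJ : c^* = c.
    by apply/CrealP/ger0_real; rewrite divr_ge0 ?addr_ge0 // ltW.
  have cK : c * (G s t * (G s t)^*) = G t t + 1 by rewrite divfK // gt_eqF.
  have := psd_kernel_two_points s t (- c * G s t) 1 psdG.
  rewrite Gs0 mulr0 add0r Ets rmorph1 !mul1r mulr1 rmorphM rmorphN /= cJ.
  have -> : - c * (G s t)^* * G s t + - c * G s t * (G s t)^* + G t t
      = - (c * (G s t * (G s t)^*)) - (c * (G s t * (G s t)^*)) + G t t by ring.
  have -> : - (c * (G s t * (G s t)^*)) - (c * (G s t * (G s t)^*)) + G t t
      = - (G t t + 1 + 1) by rewrite cK; ring.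
  rewrite oppr_ge0; apply/negP; rewrite lt_geF //.
  by apply: ltr_wpDl; rewrite ?addr_ge0 ?ltr01.
have Gpos : 0 < G s s by rewrite lt_def Gs0.
have := psd_kernel_two_points s t (- G s t) (G s s) psdG.
rewrite rmorphN Ets; have -> : (G s s)^* = G s s by apply/CrealP/ger0_real.
have -> : - (G s t)^* * - G s t * G s s + - (G s t)^* * G s s * G s t +
  G s s * - G s t * (G s t)^* + G s s * G s s * G t t
  = G s s * (G s s * G t t - G s t * (G s t)^*) by ring.
by rewrite pmulr_rge0 // subr_ge0.
Qed.

(** * Block positivity and complete positivity *)

Definition sandwich n (u : 'cV[C]_n) (M : 'M[C]_n) (w : 'cV[C]_n) : C :=
  (u^t* *m M *m w) 0 0.

Lemma sandwichE n (u : 'cV[C]_n) (M : 'M[C]_n) (w : 'cV[C]_n) :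
  sandwich u M w = \sum_k \sum_l (u k 0)^* * M k l * w l 0.
Proof.
rewrite /sandwich mxE exchange_big /=; apply: eq_bigr => l _.
by rewrite mxE mulr_suml; apply: eq_bigr => k _; rewrite !mxE.
Qed.

(** Positivity of the block matrix with blocks [B i j], phrased through the
    components of a block vector; [psdmx_mxblock] is the equivalence with
    positivity of the assembled matrix. *)
Definition block_psd n k (B : 'I_k -> 'I_k -> 'M[C]_n) :=
  forall v : 'I_k -> 'cV[C]_n, 0 <= \sum_i \sum_j sandwich (v i) (B i j) (v j).

(** Complete positivity for bare functions, so that it applies to
    [conj_map Phi U] and to compositions as well as to elements of 'End. *)
Definition cp_fun n (f : 'M[C]_n -> 'M[C]_n) :=
  forall k (B : 'I_k -> 'I_k -> 'M[C]_n),
    block_psd B -> block_psd (fun i j => f (B i j)).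

Lemma psdmx_mxblock n k (B : 'I_k -> 'I_k -> 'M[C]_n) :
  psdmx (\mxblock_(i < k, j < k) B i j) <-> block_psd B.
Proof.
have formE (v : 'I_k -> 'cV[C]_n) :
  ((\mxcol_i v i)^t* *m (\mxblock_(i < k, j < k) B i j) *m (\mxcol_i v i)) 0 0
  = \sum_i \sum_j sandwich (v i) (B i j) (v j).
  rewrite tr_mxcol.
  have -> : map_mx Num.conj (\mxrow_i (v i)^T) = \mxrow_i (v i)^t*.
    by apply/matrixP => i j; rewrite !mxE.
  rewrite mul_mxrow_mxblock mul_mxrow_mxcol summxE exchange_big /=.
  by apply: eq_bigr => j _; rewrite mulmx_suml summxE.
split=> [H v|H v]; first by rewrite -formE; apply: H.
by rewrite -[v]submxcolK formE.
Qed.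

Lemma completely_positiveP n (Phi : 'End('M[C]_n)) :
  completely_positive Phi <-> cp_fun Phi.
Proof.
split=> [H k B|H k A].
  move=> /psdmx_mxblock /H; rewrite /ampliation => {}H.
  apply/psdmx_mxblock; congr psdmx: H.
  by apply: eq_mxblock => i j; rewrite mxblockK.
by rewrite -{1}[A]submxblockK => /psdmx_mxblock /H; rewrite /ampliation psdmx_mxblock.
Qed.

Lemma block_psd_kernel n k (B : 'I_k -> 'I_k -> 'M[C]_n) :
  block_psd B -> psd_kernel (fun p q : 'I_k * 'I_n => B p.1 q.1 p.2 q.2).
Proof.
move=> H x; have := H (fun i => \col_l x (i, l)).
under eq_bigr do under eq_bigr do rewrite sandwichE.
congr (_ <= _).
transitivity (\sum_i \sum_l \sum_j \sum_m
    (x (i, l))^* * B i j l m * x (j, m)).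
  apply: eq_bigr => i _; rewrite exchange_big /=; apply: eq_bigr => l _.
  by apply: eq_bigr => j _; apply: eq_bigr => m _; rewrite !mxE.
rewrite pair_bigA; apply: eq_bigr => -[i l] _ /=.
by rewrite pair_bigA; apply: eq_bigr => -[j m] _.
Qed.

(** The quadratic form is the squared modulus of [\sum_j v j j 0]: this block
    matrix is [n] times the projection onto the maximally entangled vector. *)
Lemma choi_psd n :
  block_psd (fun i j : 'I_n => delta_mx i j : 'M[C]_n).
Proof.
move=> v.
have -> : \sum_i \sum_j sandwich (v i) (delta_mx i j) (v j)
  = `|\sum_j v j j 0| ^+ 2.
  rewrite normCK mulrC rmorph_sum mulr_suml; apply: eq_bigr => i _.
  rewrite mulr_sumr; apply: eq_bigr => j _.
  rewrite sandwichE (bigD1 i) //= (bigD1 j) //= !mxE !eqxx mulr1.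
  rewrite big1 => [|l /negPf lj]; last by rewrite mxE lj andbF mulr0 mul0r.
  rewrite addr0 big1 ?addr0 // => k /negPf ki.
  by rewrite big1 // => l _; rewrite mxE ki mulr0 mul0r.
by rewrite exprn_ge0.
Qed.

Lemma psdmx_block1 n (A : 'M[C]_n) : psdmx A <-> block_psd (fun _ _ : 'I_1 => A).
Proof.
split=> H v; first by rewrite !big_ord1; exact: H.
by have := H (fun _ => v); rewrite !big_ord1.
Qed.

Lemma cp_psdmx n (f : 'M[C]_n -> 'M[C]_n) A : cp_fun f -> psdmx A -> psdmx (f A).
Proof. by move=> cpf /psdmx_block1 /cpf /psdmx_block1. Qed.

Lemma sandwich_conj n (V A : 'M[C]_n) u w :
  sandwich u (V^t* *m A *m V) w = sandwich (V *m u) A (V *m w).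
Proof. by rewrite /sandwich trmx_mul map_mxM !mulmxA. Qed.

Lemma cp_conj n (V : 'M[C]_n) : cp_fun (fun A => V^t* *m A *m V).
Proof.
move=> k B psdB v; under eq_bigr do under eq_bigr do rewrite sandwich_conj.
exact: psdB.
Qed.

Lemma cp_comp n (f g : 'M[C]_n -> 'M[C]_n) : cp_fun f -> cp_fun g -> cp_fun (f \o g).
Proof. by move=> cpf cpg k B /cpg /cpf. Qed.

Lemma sandwichD n (u w : 'cV[C]_n) A B :
  sandwich u (A + B) w = sandwich u A w + sandwich u B w.
Proof. by rewrite /sandwich mulmxDr mulmxDl mxE. Qed.

Lemma sandwichZ n (u w : 'cV[C]_n) c A :
  sandwich u (c *: A) w = c * sandwich u A w.
Proof. by rewrite /sandwich -scalemxAr -scalemxAl mxE. Qed.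

Lemma sandwichZv n (u w : 'cV[C]_n) a b A :
  sandwich (a *: u) A (b *: w) = a^* * b * sandwich u A w.
Proof.
rewrite !sandwichE mulr_sumr; apply: eq_bigr => k _.
rewrite mulr_sumr; apply: eq_bigr => l _.
by rewrite !mxE rmorphM /=; ring.
Qed.

Lemma cp_add n (f g : 'M[C]_n -> 'M[C]_n) :
  cp_fun f -> cp_fun g -> cp_fun (fun A => f A + g A).
Proof.
move=> cpf cpg k B psdB v.
under eq_bigr do under eq_bigr do rewrite sandwichD.
under eq_bigr do rewrite big_split.
by rewrite big_split addr_ge0 ?cpf ?cpg.
Qed.

Lemma eq_cp n (f g : 'M[C]_n -> 'M[C]_n) : f =1 g -> cp_fun f -> cp_fun g.
Proof.
move=> fg cpf k B /cpf + v => /(_ v).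
by under eq_bigr do under eq_bigr do rewrite fg.
Qed.

Lemma sandwich_scalar n (u w : 'cV[C]_n) c :
  sandwich u (c *: 1%:M) w = \sum_l (u l 0)^* * c * w l 0.
Proof.
rewrite sandwichE; apply: eq_bigr => k _.
rewrite (bigD1 k) //= big1 ?addr0 => [|l /negPf lk].
  by rewrite !mxE eqxx mulr1.
by rewrite !mxE eq_sym lk !mulr0 mul0r.
Qed.

(** For each coordinate [l], contracting the blocks [B i j] with the scalars
    [v i l 0] gives a positive matrix, and the quadratic form of the image is
    the sum over [l] of the values of [rho] at these matrices. *)
Lemma cp_state n (rho : {scalar 'M[C]_n}) :
  (forall A, psdmx A -> 0 <= rho A) -> cp_fun (fun A => rho A *: 1%:M).
Proof.
move=> rho_ge0 k B psdB v.
have -> : \sum_i \sum_j sandwich (v i) (rho (B i j) *: 1%:M) (v j)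
  = \sum_l rho (\sum_i \sum_j ((v i l 0)^* * v j l 0) *: B i j).
  under eq_bigr do under eq_bigr do rewrite sandwich_scalar.
  under eq_bigr do rewrite exchange_big.
  rewrite exchange_big; apply: eq_bigr => l _ /=.
  rewrite linear_sum; apply: eq_bigr => i _ /=.
  rewrite linear_sum; apply: eq_bigr => j _ /=.
  by rewrite linearZ /= mulrAC.
apply: sumr_ge0 => l _; apply: rho_ge0 => w.
have := psdB (fun i => v i l 0 *: w); congr (_ <= _).
rewrite mulmx_sumr mulmx_suml summxE; apply: eq_bigr => i _.
rewrite mulmx_sumr mulmx_suml summxE; apply: eq_bigr => j _.
by rewrite -/(sandwich _ _ _) sandwichZ sandwichZv.
Qed.

End Forms.

(** * The Choi matrix of a completely positive map *)

Lemma eq_linear_delta (C : pzRingType) (V : lmodType C) n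
    (f g : {linear 'M[C]_n -> V}) :
  (forall i j, f (delta_mx i j) = g (delta_mx i j)) -> f =1 g.
Proof.
move=> fg A; rewrite [A]matrix_sum_delta !linear_sum; apply: eq_bigr => i _ /=.
by rewrite !linear_sum; apply: eq_bigr => j _ /=; rewrite !linearZ /= fg.
Qed.

Lemma linear_entry (C : pzRingType) n (f : {linear 'M[C]_n -> 'M[C]_n}) A k l :
  f A k l = \sum_i \sum_j A i j * f (delta_mx i j) k l.
Proof.
rewrite {1}[A]matrix_sum_delta linear_sum summxE; apply: eq_bigr => i _.
by rewrite linear_sum summxE; apply: eq_bigr => j _; rewrite linearZ mxE.
Qed.

Section CP.
Variable C : numClosedFieldType.

Lemma trmxC_delta n (i j : 'I_n) : (delta_mx i j : 'M[C]_n)^t* = delta_mx j i.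
Proof. by rewrite trmx_delta map_delta_mx. Qed.

Section CPfun.
Variables (n : nat) (f : {linear 'M[C]_n -> 'M[C]_n}).
Hypothesis cpf : cp_fun f.

Let choi_kernel : psd_kernel
  (fun p q : 'I_n * 'I_n => f (delta_mx p.1 q.1) p.2 q.2).
Proof. exact: block_psd_kernel (cpf (@choi_psd C n)). Qed.

Lemma cp_adjoint A : f (A^t*) = (f A)^t*.
Proof.
have fdelta i j : f (delta_mx j i) = (f (delta_mx i j))^t*.
  apply/matrixP => k l; rewrite !mxE.
  exact: (psd_kernel_conj (i, l) (j, k) choi_kernel).
apply/matrixP => k l.
rewrite (linear_entry f) exchange_big !mxE (linear_entry f).
rewrite rmorph_sum; apply: eq_bigr => i _; rewrite rmorph_sum.
by apply: eq_bigr => j _; rewrite rmorphM /= fdelta !mxE.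
Qed.

Lemma cp_diag_ge0 i k : 0 <= f (delta_mx i i) k k.
Proof. exact: (psd_kernel_diag (i, k) choi_kernel). Qed.

(** The 2 x 2 minor of the Choi matrix on the rows [(i, k)] and [(j, l)]. *)
Lemma cp_delta_minor i j k l :
  `|f (delta_mx i j) k l| ^+ 2 <= f (delta_mx i i) k k * f (delta_mx j j) l l.
Proof. exact: (psd_kernel_minor (i, k) (j, l) choi_kernel). Qed.

(** The diagonal entries of the Choi matrix are nonnegative and those with a
    given inner index sum to [c], so each is at most [c]; minors do the rest. *)
Lemma cp_delta_le c i j k l : f 1%:M = c%:M -> `|f (delta_mx i j) k l| <= c.
Proof.
move=> f1.
have diag_le m q : f (delta_mx m m) q q <= c.
  have -> : c = \sum_i f (delta_mx i i) q q.
    rewrite -summxE -linear_sum /=.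
    by rewrite -(mx1_sum_delta C n) f1 mxE eqxx.
  by rewrite (bigD1 m) //= lerDl sumr_ge0 // => p _; exact: cp_diag_ge0.
have c0 : 0 <= c := le_trans (cp_diag_ge0 i k) (diag_le i k).
rewrite -(ler_pXn2r (n := 2)) ?nnegrE //.
apply: le_trans (cp_delta_minor i j k l) _.
by rewrite expr2 ler_pM ?cp_diag_ge0.
Qed.

Lemma cp_entry_bound c B k l :
  f 1%:M = c%:M -> `|f B k l| <= c * \sum_i \sum_j `|B i j|.
Proof.
move=> f1; rewrite (linear_entry f) mulr_sumr.
apply: le_trans (ler_norm_sum _ _ _) _; apply: ler_sum => i _.
rewrite mulr_sumr.
apply: le_trans (ler_norm_sum _ _ _) _; apply: ler_sum => j _.
by rewrite normrM mulrC ler_wpM2r // cp_delta_le.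
Qed.

(** The Choi matrix then has a zero diagonal entry at [(i, k)] unless [i = k],
    and a positive matrix vanishes on the row and column of such an entry. *)
Lemma cp_schur_multiplier : (forall i, f (delta_mx i i) = delta_mx i i) ->
  forall A k l, f A k l = f (delta_mx k l) k l * A k l.
Proof.
move=> fdiag A k l.
have off i j : (i != k) || (j != l) -> f (delta_mx i j) k l = 0.
  move=> ikjl; have := cp_delta_minor i j k l; rewrite !fdiag !mxE !andbb.
  rewrite -natrM mulnb ![_ == i]eq_sym ![_ == j]eq_sym -[_ && _]negbK negb_and ikjl => h.
  by apply/eqP; rewrite -normr_eq0 -sqrf_eq0 eq_le h exprn_ge0.
rewrite (linear_entry f) (bigD1 k) //= (bigD1 l) //= big1 => [|j jl].
  rewrite addr0 big1 ?addr0 1?mulrC // => i ik.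
  by rewrite big1 // => j _; rewrite off ?ik // mulr0.
by rewrite off ?jl ?orbT // mulr0.
Qed.
End CPfun.
End CP.

(** * Unitary conjugation *)

Lemma ord2E (k : 'I_2) : k = 0 \/ k = 1.
Proof. by case: k => -[|[|//]] lt2; [left|right]; exact: val_inj. Qed.

Section Conj.
Variables (C : numClosedFieldType) (n : nat).
Implicit Types (Phi : 'End('M[C]_n)) (U A : 'M[C]_n).

Lemma conj_map_is_linear Phi U : linear (conj_map Phi U).
Proof.
move=> a A B; rewrite /conj_map.
by rewrite mulmxDr mulmxDl linearD /= -scalemxAr -scalemxAl linearZ /= mulmxDr
   mulmxDl -scalemxAr -scalemxAl.
Qed.
HB.instance Definition _ Phi U :=
  GRing.isLinear.Build C 'M[C]_n 'M[C]_n _ (conj_map Phi U)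
    (conj_map_is_linear Phi U).

Definition entry00 (Phi : 'End('M[C]_n.+1)) (A : 'M[C]_n.+1) : C := Phi A 0 0.
Lemma entry00_is_linear (Phi : 'End('M[C]_n.+1)) : scalar (entry00 Phi).
Proof. by move=> a A B; rewrite /entry00 linearD linearZ !mxE. Qed.
HB.instance Definition _ (Phi : 'End('M[C]_n.+1)) :=
  GRing.isLinear.Build C 'M[C]_n.+1 C _ (entry00 Phi) (entry00_is_linear Phi).

Lemma unitaryV U : U \is unitarymx -> U *m U^t* = 1%:M.
Proof. by move/unitarymxP. Qed.

Lemma unitaryVt U : U \is unitarymx -> U^t* *m U = 1%:M.
Proof. by move=> /unitaryV /mulmx1C. Qed.

Lemma conj_mapK Phi U A : U \is unitarymx ->
  Phi A = U *m conj_map Phi U (U^t* *m A *m U) *m U^t*.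
Proof.
move=> uU; rewrite /conj_map !mulmxA unitaryV // !mul1mx.
by rewrite -!mulmxA unitaryV // !mulmx1.
Qed.

Lemma conj_map_idem Phi U A : U \is unitarymx -> (Phi \o Phi)%VF = Phi ->
  conj_map Phi U (conj_map Phi U A) = conj_map Phi U A.
Proof.
move=> uU /lfunP idem; rewrite /conj_map !mulmxA unitaryV // mul1mx.
rewrite -!mulmxA unitaryV // mulmx1; move: (idem (U *m (A *m U^t*))).
by rewrite lfunE /= => ->.
Qed.

Lemma conj_map_cp Phi U : cp_fun Phi -> cp_fun (conj_map Phi U).
Proof.
move=> cpPhi; have cp1 := cp_comp cpPhi (cp_conj (U^t*)).
have := cp_comp (cp_conj U) cp1.
by apply: eq_cp => A; rewrite /= trmxCK.
Qed.

Lemma conj_map1 Phi : conj_map Phi 1%:M =1 Phi.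
Proof.
by move=> A; rewrite /conj_map trmx1 map_mx1 !mul1mx !mulmx1.
Qed.

End Conj.

Lemma scalar_valued (C : numClosedFieldType) n (Phi : 'End('M[C]_n.+1)) :
  (forall i j, is_scalar_mx (Phi (delta_mx i j))) ->
  forall A, Phi A = entry00 Phi A *: 1%:M.
Proof.
move=> sc.
pose g A := entry00 Phi A *: (1%:M : 'M[C]_n.+1).
have lg : linear g by move=> a A B; rewrite /g linearP scalerDl scalerA.
pose gL : {linear _ -> _} := HB.pack g (GRing.isLinear.Build _ _ _ _ _ lg).
apply: (eq_linear_delta (g := gL)) => i j; rewrite /= /g /entry00.
by have /is_scalar_mxP[a ->] := sc i j; rewrite mxE eqxx mulr1n scale_scalar_mx mulr1.
Qed.

(** The Hermitian and skew-Hermitian parts of [X] are fixed as well, because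
    [f] commutes with the adjoint; they cannot both be scalar. *)
Lemma hermitian_fixed_point (C : numClosedFieldType) n
    (f : {linear 'M[C]_n -> 'M[C]_n}) X :
  cp_fun f -> f X = X -> ~~ is_scalar_mx X ->
  exists H, [/\ H \is hermsymmx, f H = H & ~~ is_scalar_mx H].
Proof.
move=> cpf fX nX.
have fXt : f (X^t*) = X^t* by rewrite cp_adjoint // fX.
have conjD (A B : 'M[C]_n) : (A + B)^t* = A^t* + B^t* by rewrite linearD /= map_mxD.
pose H1 := X + X^t*; pose H2 := 'i *: (X - X^t*).
have [/is_scalar_mxP[a H1a]|nH1] := boolP (is_scalar_mx H1); last first.
  exists H1; split=> //; last by rewrite linearD /= fX fXt.
  by apply/is_hermitianmxP; rewrite expr0 scale1r conjD trmxCK addrC.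
have [/is_scalar_mxP[b H2b]|nH2] := boolP (is_scalar_mx H2); last first.
  exists H2; split=> //; last by rewrite linearZ /= linearB /= fX fXt.
  apply/is_hermitianmxP; rewrite expr0 scale1r /H2.
  apply/matrixP => i j; rewrite !mxE rmorphM rmorphB /= conjCK conjCi; ring.
case/negP: nX; apply/is_scalar_mxP; exists (2%:R^-1 * (a - 'i * b)).
have -> : X = 2%:R^-1 *: (H1 - 'i *: H2).
  rewrite /H2 scalerA -expr2 sqrCi scaleN1r opprK addrACA subrr addr0.
  by rewrite -mulr2n -scaler_nat scalerA mulVf ?scale1r ?pnatr_eq0.
by rewrite H1a H2b !(scale_scalar_mx, =^~ raddfB) /=.
Qed.

(** * Classification on 2 x 2 matrices *)

Lemma ucp_idempotent_forms (C : numClosedFieldType) (Phi : 'End('M[C]_2)) :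
  ucp_idempotent Phi ->
  exists2 U : 'M[C]_2, U \is unitarymx &
        [\/ exists2 rho : {scalar 'M[C]_2}, is_state rho &
              forall A : 'M[C]_2, conj_map Phi U A = rho A *: 1%:M,
            forall A : 'M[C]_2,
              conj_map Phi U A =
                A 0 0 *: delta_mx 0 0 + A 1 1 *: delta_mx 1 1
          | forall A : 'M[C]_2, conj_map Phi U A = A].
Proof.
move=> [uPhi /completely_positiveP cpPhi idPhi].
rewrite /unital in uPhi.
have [sc|] := boolP [forall i, forall j, is_scalar_mx (Phi (delta_mx i j))].
  exists 1%:M; first by apply/unitarymxP; rewrite trmx1 map_mx1 mulmx1.
  constructor 1; exists (entry00 Phi).
    split; last by rewrite /= /entry00 uPhi mxE.
    move=> A /(cp_psdmx cpPhi) /psdmx_block1 /block_psd_kernel.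
    by move/(psd_kernel_diag (0, 0)).
  move=> A; rewrite conj_map1; apply: scalar_valued => i j.
  by move/forallP: sc => /(_ i) /forallP.
case/forallPn => i /forallPn[j nX].
set X := Phi (delta_mx i j) in nX.
have fX : Phi X = X by move/lfunP: idPhi => /(_ (delta_mx i j)); rewrite lfunE.
have [H [hH fH nH]] := hermitian_fixed_point cpPhi fX nX.
have := hermitian_normalmx hH => /orthomx_spectralP.
set P := spectralmx H; set d := spectral_diag H => HE.
have uP : P \is unitarymx by exact: spectral_unitarymx.
rewrite invmx_unitary // in HE.
pose U := P^t*; have uU : U \is unitarymx by rewrite trmxC_unitary.
pose f : {linear _ -> _} := conj_map Phi U.
have cpf : cp_fun f by exact: conj_map_cp.
have f1 : f 1%:M = 1%:M.
  by rewrite /f /= /conj_map mulmx1 unitaryV // uPhi mulmx1 unitaryVt.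
have ff A : f (f A) = f A by exact: conj_map_idem.
have fD : f (diag_mx d) = diag_mx d.
  rewrite /f /= /conj_map trmxCK -HE fH HE !mulmxA unitaryV // mul1mx.
  by rewrite -mulmxA unitaryV // mulmx1.
have d01 : d 0 0 - d 0 1 != 0.
  apply: contra nH => /eqP/subr0_eq d01; apply/is_scalar_mxP; exists (d 0 0).
  have -> : H = d 0 0 *: (P^t* *m P).
    rewrite HE scalemxAr -mulmxA; congr (_ *m _).
    apply/matrixP => k l; rewrite mul_diag_mx !mxE.
    suff -> : d 0 k = d 0 0 by [].
    by case: (ord2E k) => ->; first by []; exact/esym.
  by rewrite unitaryVt // scale_scalar_mx mulr1.
have fe0 : f (delta_mx 0 0) = delta_mx 0 0.
  have -> : delta_mx 0 0 = (d 0 0 - d 0 1)^-1 *: (diag_mx d - d 0 1 *: 1%:M).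
    apply/matrixP => k l; rewrite !mxE.
    by case: (ord2E k) => ->; case: (ord2E l) => ->;
      rewrite /= ?mulr1n ?mulr0n ?mulr1 ?mulr0 ?subrr ?subr0 ?mulr0 ?mulVf.
  by rewrite linearZ /= linearB /= fD linearZ /= f1.
have fdiag m : f (delta_mx m m) = delta_mx m m.
  case: (ord2E m) => -> //.
  have -> : delta_mx 1 1 = 1%:M - delta_mx 0 0 :> 'M[C]_2.
    apply/matrixP => k l; rewrite !mxE.
    by case: (ord2E k) => ->; case: (ord2E l) => ->; rewrite /= ?subr0 ?subrr.
  by rewrite linearB /= f1 fe0.
have schur := cp_schur_multiplier cpf fdiag.
pose s := f (delta_mx 0 1) 0 1.
have s10 : f (delta_mx 1 0) 1 0 = s^*.
  by rewrite -(trmxC_delta C 0 1) (cp_adjoint cpf) 2!mxE.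
have ss : s * (s - 1) = 0.
  by rewrite mulrBr mulr1 -schur ff subrr.
exists U => //.
have fE A : f A = A 0 0 *: delta_mx 0 0 + s * A 0 1 *: delta_mx 0 1
    + (s^* * A 1 0 *: delta_mx 1 0 + A 1 1 *: delta_mx 1 1).
  apply/matrixP => k l; rewrite schur.
  by case: (ord2E k) => ->; case: (ord2E l) => ->;
    rewrite ?fdiag ?s10 -/s !mxE /= ?(mulr0, mulr1, mul1r, addr0, add0r).
move/eqP: ss; rewrite mulf_eq0 subr_eq0 => /orP[/eqP s0|/eqP s1].
  constructor 2 => A; rewrite -/(f A) fE s0 rmorph0 !mul0r !scale0r.
  by rewrite addr0 add0r.
constructor 3 => A; rewrite -[LHS]/(f A) fE s1 rmorph1 !mul1r.
rewrite [RHS]matrix_sum_delta !big_ord_recl !big_ord0 !addr0.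
by congr (_ *: delta_mx _ _ + _ *: delta_mx _ _ +
    (_ *: delta_mx _ _ + _ *: delta_mx _ _));
   try (congr (A _ _)); exact/val_inj.
Qed.

Lemma delta_mx_compress (C : pzRingType) n (A : 'M[C]_n) i :
  delta_mx i i *m A *m delta_mx i i = A i i *: delta_mx i i.
Proof.
apply/matrixP => k l; rewrite !mxE (bigD1 i) //= big1 => [|j /negPf ji].
  rewrite mxE (bigD1 i) //= big1 => [|j /negPf ji]; last first.
    by rewrite mxE ji andbF mul0r.
  rewrite !mxE !eqxx andbT /= !addr0 -mulrA mulr_natl mulr_natr -mulrnA mulnb.
  by rewrite andbC mulr_natr.
by rewrite [X in _ * X]mxE ji mulr0.
Qed.

Section Converse.
Variable C : numClosedFieldType.

Lemma ucp_idempotent_conj n (Phi : 'End('M[C]_n)) U :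
  unital Phi -> U \is unitarymx -> cp_fun (conj_map Phi U) ->
  (forall A, conj_map Phi U (conj_map Phi U A) = conj_map Phi U A) ->
  ucp_idempotent Phi.
Proof.
move=> uPhi uU cpf ff; split=> //.
  apply/completely_positiveP.
  have := cp_comp (cp_conj (U^t*)) (cp_comp cpf (cp_conj U)).
  by apply: eq_cp => A; rewrite /= trmxCK [RHS](conj_mapK _ _ uU).
have UK X : U^t* *m (U *m X *m U^t*) *m U = X.
  by rewrite !mulmxA unitaryVt // mul1mx -mulmxA unitaryVt // mulmx1.
by apply/lfunP => A; rewrite lfunE /= !(conj_mapK Phi _ uU) UK ff.
Qed.

Lemma forms_ucp_idempotent (Phi : 'End('M[C]_2)) (U : 'M[C]_2) :
  unital Phi -> U \is unitarymx ->
  [\/ exists2 rho : {scalar 'M[C]_2}, is_state rho &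
        forall A : 'M[C]_2, conj_map Phi U A = rho A *: 1%:M,
      forall A : 'M[C]_2,
        conj_map Phi U A = A 0 0 *: delta_mx 0 0 + A 1 1 *: delta_mx 1 1
    | forall A : 'M[C]_2, conj_map Phi U A = A] ->
  ucp_idempotent Phi.
Proof.
move=> uPhi uU [[rho [rho_ge0 rho1] fE]|fE|fE]; apply: (ucp_idempotent_conj uPhi uU).
- by apply: eq_cp (cp_state rho_ge0) => A; rewrite fE.
- by move=> A; rewrite !fE linearZ /= rho1 mulr1.
- have := cp_add (cp_conj (delta_mx 0 0)) (cp_conj (delta_mx 1 1 : 'M[C]_2)).
  apply: eq_cp => A; rewrite fE !trmxC_delta.
  by rewrite !delta_mx_compress.
- move=> A; rewrite !fE !mxE /=; by rewrite !(mulr0, mulr1, addr0, add0r).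
- by move=> k B psdB v; under eq_bigr do under eq_bigr do rewrite fE.
- by move=> A; rewrite !fE.
Qed.

Lemma rank_ucp_idempotent (Phi : 'End('M[C]_2)) :
  ucp_idempotent Phi -> \dim (limg Phi) <> 3%N.
Proof.
move=> /ucp_idempotent_forms[U uU forms].
have limg_sub (V : {vspace 'M[C]_2}) :
    (forall A, Phi A \in V) -> (\dim (limg Phi) <= \dim V)%N.
  by move=> PhiV; apply/dimvS/subvP => _ /memv_imgP[A _ ->].
case: forms => [[rho _ fE]|fE|fE].
- have /limg_sub : forall A, Phi A \in <[1%:M]>%VS.
    move=> A; rewrite (conj_mapK Phi _ uU) fE -scalemxAr mulmx1 -scalemxAl unitaryV //.
    by rewrite memvZ ?memv_line.
  by rewrite dim_vline => + d3; rewrite d3; case: (_ != _).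
- have /limg_sub : forall A, Phi A \in
     (<[(U *m delta_mx 0 0 *m U^t*)%R]> + <[(U *m delta_mx 1 1 *m U^t*)%R]>)%VS.
    move=> A; rewrite (conj_mapK Phi _ uU) fE mulmxDr mulmxDl.
    by rewrite -!scalemxAr -!scalemxAl memv_add // memvZ ?memv_line.
  move=> le_dim d3; have := leq_trans le_dim (dimv_add_leqif _ _).
  by rewrite d3 !dim_vline; do 2!case: (_ != _).
- have -> : Phi = \1%VF.
    apply/lfunP => A; rewrite (conj_mapK Phi _ uU) fE !mulmxA unitaryV // mul1mx.
    by rewrite -mulmxA unitaryV // mulmx1 id_lfunE.
  by rewrite lim1g dimvf dim_matrix.
Qed.
End Converse.

(** * The projection attached to a unital q-positive map *)

Section QPositive.
Variable C : numClosedFieldType.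

Lemma linear_growth_bounded_eq0 (a c : C) :
  0 <= a -> (forall t, 0 <= t -> a * (1 + t) <= c) -> a = 0.
Proof.
move=> a0 bound; have [//|an0] := eqVneq a 0.
have apos : 0 < a by rewrite lt_def an0.
have c0 : 0 <= c.
  by have := bound 0 (lexx 0); rewrite addr0 mulr1; apply: le_trans.
have := bound (c / a) (divr_ge0 c0 a0).
rewrite mulrDr mulr1 mulrC divfK // gerDr.
by move/(lt_le_trans apos); rewrite ltxx.
Qed.

Variables (n : nat) (phi : 'End('M[C]_n)).
Hypotheses (uphi : unital phi) (qphi : q_positive phi).

Let psi (t : C) : 'End('M[C]_n) := (phi \o (\1%VF + t *: phi)%R^-1)%VF.

(** A nonzero kernel vector of [1 + t phi] would be an eigenvector of [phi] for
    the negative eigenvalue [- t^-1]; hence the inverse is a true one. *)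
Lemma psi_resolvent t x : 0 <= t -> psi t (x + t *: phi x) = phi x.
Proof.
move=> t0; have -> : x + t *: phi x = (\1%VF + t *: phi) x by rewrite !lfunE /= !lfunE.
rewrite lfunE /= lker0_lfunK //.
rewrite -subv0; apply/subvP => y; rewrite memv_ker !lfunE /= !lfunE /= => /eqP yt.
have [t00|tn0] := eqVneq t 0; first by rewrite memv0 -yt t00 scale0r addr0.
have neg : - t^-1 < 0 by rewrite oppr_lt0 invr_gt0 lt_def tn0.
have := qphi.1 _ neg; rewrite /passmx.leigenvalue negbK => /eqP ker0.
rewrite -ker0 memv_ker !lfunE /= !lfunE /= !lfunE /=.
rewrite scaleNr opprK -(inj_eq (scalerI tn0)) scaler0 scalerDr scalerA divff // scale1r.
by rewrite id_lfunE addrC yt.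
Qed.

Lemma psi_cp t : 0 <= t -> cp_fun (psi t).
Proof. by move=> t0; apply/completely_positiveP; exact: qphi.2. Qed.

(** By the resolvent identity at [1], [psi t 1 = (1 + t)^-1]. *)
Lemma psi_bound t B k l : 0 <= t ->
  `|psi t B k l| * (1 + t) <= \sum_i \sum_j `|B i j|.
Proof.
move=> t0; have t1 : 0 < 1 + t by rewrite ltr_wpDr.
have := psi_resolvent 1%:M t0.
rewrite [phi _]uphi -[X in X + _]scale1r -scalerDl linearZ /=.
move/(congr1 (fun X => (1 + t)^-1 *: X)).
rewrite scalerA mulVf ?gt_eqF // scale1r scale_scalar_mx mulr1.
move=> /(cp_entry_bound (psi_cp t0) B k l).
by rewrite ler_pdivlMl // mulrC.
Qed.

(** If [x = phi y] and [phi x = 0], then [psi t x = 0], so the resolvent identity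
    at [y] reads [psi t y = x], which tends to 0 as [t] grows. *)
Lemma phi_ker_limg : (limg phi :&: lker phi = 0)%VS.
Proof.
apply/eqP; rewrite -subv0; apply/subvP => x /memv_capP[/memv_imgP[y _ xE]].
rewrite memv_ker memv0 => /eqP phix0; apply/eqP/matrixP => k l; rewrite [RHS]mxE.
apply/eqP; rewrite -normr_eq0; apply/eqP.
apply: (linear_growth_bounded_eq0 (c := \sum_i \sum_j `|y i j|)) => // t t0.
suff -> : x = psi t y by exact: psi_bound.
have px : psi t x = 0 by have := psi_resolvent x t0; rewrite phix0 scaler0 addr0.
by have := psi_resolvent y t0; rewrite -xE linearD linearZ /= px scaler0 addr0.
Qed.

Lemma q_positive_projection :
  exists2 P : 'End('M[C]_n), ucp_idempotent P & limg P = limg phi.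
Proof.
have imgphi2 : limg (phi \o phi)%VF = limg phi.
  apply/eqP; rewrite eqEdim limg_comp limgS ?subvf //=.
  by rewrite (limg_dim_eq phi_ker_limg).
(* [phi^2] has the same range as [phi], so this [W] solves
   [phi (phi (W z)) = phi z]. *)
pose W := ((phi \o phi)^-1 \o phi)%VF.
have WE z : phi (phi (W z)) = phi z.
  have : phi z \in limg (phi \o phi)%VF by rewrite imgphi2 memv_img ?memvf.
  by move=> /limg_lfunVK E; rewrite -[RHS]E /W !comp_lfunE.
pose P := (phi \o W)%VF.
have PE z : P z = phi (W z) by rewrite lfunE.
have inj_img x y : x \in limg phi -> y \in limg phi -> phi x = phi y -> x = y.
  move=> ix iy xy; apply/subr0_eq/eqP; rewrite -memv0 -phi_ker_limg memv_cap.
  by rewrite memvB //= memv_ker linearB /= xy subrr.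
have img x : phi x \in limg phi by rewrite memv_img ?memvf.
have Pphi x : P (phi x) = phi x by apply: inj_img; rewrite ?PE ?WE ?img.
have Ppsi t z : 0 <= t -> P z = t *: psi t z + psi t (W z).
  move=> t0; have := psi_resolvent (W z) t0; rewrite -PE linearD linearZ /= => <-.
  rewrite addrC; congr (_ *: _ + _).
  have : psi t (z - P z) = 0.
    have ker0 : phi (z - P z) = 0 by rewrite linearB /= PE WE subrr.
    by have := psi_resolvent (z - P z) t0; rewrite ker0 scaler0 addr0.
  by rewrite linearB /= => /subr0_eq.
exists P; last first.
  apply/eqP; rewrite eqEsubv; apply/andP; split; apply/subvP => _ /memv_imgP[x _ ->].
    by rewrite PE img.
  by rewrite -Pphi memv_img ?memvf.
split.
- by rewrite /unital -{1}uphi Pphi uphi.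
- apply/completely_positiveP => k B psdB v.
  set q := (X in 0 <= X).
  pose q1 t := \sum_i \sum_j sandwich (v i) (psi t (B i j)) (v j).
  pose q2 t := \sum_i \sum_j sandwich (v i) (psi t (W (B i j))) (v j).
  have qE t : 0 <= t -> q = t * q1 t + q2 t.
    move=> t0; rewrite /q /q1 /q2 mulr_sumr -big_split; apply: eq_bigr => i _.
    rewrite mulr_sumr -big_split; apply: eq_bigr => j _.
    by rewrite /= (Ppsi t) // sandwichD sandwichZ.
  pose c := \sum_i \sum_j \sum_k \sum_l
    `|v i k 0| * (\sum_m \sum_r `|W (B i j) m r|) * `|v j l 0|.
  have q2_le t : 0 <= t -> `|q2 t| * (1 + t) <= c.
    move=> t0; have t1 : 0 <= 1 + t by rewrite addr_ge0.
    rewrite /q2 -(ger0_norm t1) -normrM mulr_suml.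
    apply: le_trans (ler_norm_sum _ _ _) _; apply: ler_sum => i _.
    rewrite mulr_suml.
    apply: le_trans (ler_norm_sum _ _ _) _; apply: ler_sum => j _.
    rewrite sandwichE mulr_suml.
    apply: le_trans (ler_norm_sum _ _ _) _; apply: ler_sum => a _.
    rewrite mulr_suml.
    apply: le_trans (ler_norm_sum _ _ _) _; apply: ler_sum => b _.
    rewrite !normrM norm_conjC (ger0_norm t1) mulrAC ler_wpM2r // -mulrA.
    by rewrite ler_wpM2l // psi_bound.
  (* Nonnegativity of the complex number [q] as the equation [q = `|q|]: this
     covers its being real, and it is stable under small errors. *)
  suff : q - `|q| = 0 by move/subr0_eq ->; rewrite normr_ge0.
  apply/eqP; rewrite -normr_eq0; apply/eqP.
  apply: (linear_growth_bounded_eq0 (c := 2%:R * c)) => // t t0.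
  have q1_ge0 : 0 <= t * q1 t by rewrite mulr_ge0 // psi_cp.
  have t1 : 0 <= 1 + t by rewrite addr_ge0.
  apply: le_trans (_ : (2%:R * `|q2 t|) * (1 + t) <= _); last first.
    by rewrite -mulrA ler_wpM2l // q2_le.
  apply: ler_wpM2r => //.
  have -> : q - `|q| = q2 t + (`|t * q1 t| - `|q|).
    by rewrite (ger0_norm q1_ge0) {1}(qE t t0); ring.
  apply: le_trans (ler_normD _ _) _; rewrite mulr_natl mulr2n lerD2l.
  apply: le_trans (ler_dist_dist _ _) _.
  by rewrite (qE t t0) opprD addrA subrr sub0r normrN.
- by apply/lfunP => z; rewrite lfunE /= !PE -[RHS]Pphi PE.
Qed.

End QPositive.

Theorem proposition3p3 (R : realType) :
  (forall Phi : 'End('M[R[i]]_2), unital Phi ->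
     (ucp_idempotent Phi <->
      exists2 U : 'M[R[i]]_2, U \is unitarymx &
        [\/ exists2 rho : {scalar 'M[R[i]]_2}, is_state rho &
              forall A : 'M[R[i]]_2, conj_map Phi U A = rho A *: 1%:M,
            forall A : 'M[R[i]]_2,
              conj_map Phi U A =
                A 0 0 *: delta_mx 0 0 + A 1 1 *: delta_mx 1 1
          | forall A : 'M[R[i]]_2, conj_map Phi U A = A])) /\
  (forall phi : 'End('M[R[i]]_2), unital phi -> q_positive phi ->
     \dim (limg phi) <> 3%N).
Proof.
split=> [Phi uPhi|phi uphi qphi].
  split=> [|[U uU forms]]; first exact: ucp_idempotent_forms.
  exact: forms_ucp_idempotent uU forms.
have [P ucpP <-] := q_positive_projection uphi qphi.
exact: rank_ucp_idempotent.
Qed.
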